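(* Let $m,c,d>0$ be constants and, for $z>0$, let $$\mu(z)=\frac{30\,mc}{d}\,\frac{z^{6}}{\left(2z^{2}+4z+1\right)^{2}}\,\mathcal{I}(z)^{-1},\qquad \mathcal{I}(z)=\int_{2/z}^{\infty}e^{-\left(x-\frac{2}{z}\right)}\left(\frac{1}{x}+\frac{3}{x^{2}}+\frac{3}{x^{3}}\right)\left(z^{2}x^{2}-4\right)^{5/2}dx .$$ Then $\mu(z)\to 0^{+}$ as $z\to 0^{+}$.
   Context: The function $\mu$ is the bulk viscosity of a two-dimensional relativistic gas of hard disks, as a function of the relativistic parameter $z=kT/(mc^{2})>0$; here $m$ (particle mass), $c$ (speed of light) and $d$ (hard-disk parameter in the cross section) are positive real constants. The notation $\mu(z)\to 0^{+}$ means that $\mu(z)$ tends to $0$ through positive values, i.e. the limit is $0$ and $\mu(z)>0$ for $z$ near the limiting point. *)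

(* Defs.v *)
From mathcomp Require Import all_boot all_order all_algebra.
From mathcomp Require Import all_classical all_reals all_analysis.
Set Implicit Arguments.
Unset Strict Implicit.
Unset Printing Implicit Defensive.
Import Order.TTheory GRing.Theory Num.Theory.
Import numFieldNormedType.Exports.
Local Open Scope classical_set_scope.
Local Open Scope ring_scope.

(* The integral is the real-valued Lebesgue integral; the integrand is
   nonnegative on the domain (for z > 0), so this agrees with the improper
   Riemann integral. [Rintegral] maps a divergent integral to 0, which would
   make [bulk_viscosity] vanish there, hence not positive. *)
Definition viscosity_integral (R : realType) (z : R) : R :=
  Rintegral (@lebesgue_measure R) `[2 / z, +oo[
    (fun x : R => expR (- (x - 2 / z))
                  * (x^-1 + 3 / x ^+ 2 + 3 / x ^+ 3)
                  * (z ^+ 2 * x ^+ 2 - 4) `^ (5 / 2)).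

Definition bulk_viscosity (R : realType) (m c d z : R) : R :=
  30 * m * c / d * (z ^+ 6 / (2 * z ^+ 2 + 4 * z + 1) ^+ 2)
  * (viscosity_integral z)^-1.

(* Main.v *)
(** The prefactor of mu(z) is O(z^6), so it is enough that the integral I(z) is
    finite and bounded below by a multiple of z^4.  On [2/z + 1, 2/z + 2], for
    z <= 1/4, one has e^{-(x - 2/z)} >= e^{-2}, 1/x >= z/4 and
    z^2 x^2 - 4 >= 4z; since 4z <= 1, (4z)^{5/2} >= (4z)^3 and
    I(z) >= 16 e^{-2} z^4, whence 0 < mu(z) <= const * z^2.  Finiteness holds
    because the integrand is dominated by a multiple of e^{-x/2}; without it
    the real-valued integral would be the junk value 0. *)
Require Import Defs.
From mathcomp Require Import all_boot all_order all_algebra.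
From mathcomp Require Import all_classical all_reals all_analysis.
From mathcomp Require Import measurable_realfun.
From mathcomp Require Import ring lra.
Set Implicit Arguments.
Unset Strict Implicit.
Unset Printing Implicit Defensive.
Import Order.TTheory GRing.Theory Num.Theory.
Import numFieldNormedType.Exports.
Local Open Scope classical_set_scope.
Local Open Scope ring_scope.

(** Copies the integrand inside [viscosity_integral] verbatim, so the two are convertible and facts
    about it transfer without rewriting. *)
Definition viscosity_integrand (R : realType) (z x : R) : R :=
  expR (- (x - 2 / z)) * (x^-1 + 3 / x ^+ 2 + 3 / x ^+ 3)
  * (z ^+ 2 * x ^+ 2 - 4) `^ (5 / 2).

(** Continuity of the inverse holds away from 0, hence the open half-line, which contains every [[2
    / z, +oo[] with z > 0. *)
Lemma measurable_inv_gt0 (R : realType) :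
  measurable_fun (`]0, +oo[ : set R) (fun x : R => x^-1).
Proof.
apply: open_continuous_measurable_fun; first exact: interval_open.
move=> x; rewrite inE/= in_itv/= andbT => x0.
by apply: inv_continuous; rewrite gt_eqF.
Qed.

Lemma powR_sqr_half5 (R : realType) (y : R) : 0 <= y ->
  (y ^+ 2) `^ (5 / 2) = y ^+ 5.
Proof.
move=> y0; rewrite -powR_mulrn// -powRrM -(powR_mulrn 5)//.
by congr (_ `^ _); field.
Qed.

Lemma measurable_viscosity_integrand (R : realType) (z : R) :
  measurable_fun (`]0, +oo[ : set R) (viscosity_integrand z).
Proof.
have mid : measurable_fun (`]0, +oo[ : set R) (@idfun R) by exact: measurable_id.
have mV := @measurable_inv_gt0 R.
rewrite /viscosity_integrand.
apply: measurable_funM.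
  apply: measurable_funM.
    apply: measurableT_comp; first exact: measurable_expR.
    by apply: measurableT_comp => //; apply: measurable_funB.
  apply: measurable_funD.
    apply: measurable_funD => //.
    apply: measurable_funM => //.
    rewrite (_ : (fun x : R => _) = (fun x => (x^-1) ^+ 2)).
      exact: measurable_funX.
    by apply/funext => x; rewrite exprVn.
  apply: measurable_funM => //.
  rewrite (_ : (fun x : R => _) = (fun x => (x^-1) ^+ 3)).
    exact: measurable_funX.
  by apply/funext => x; rewrite exprVn.
apply: (measurableT_comp (measurable_powR (5 / 2))).
by apply: measurable_funB => //; apply: measurable_funM.
Qed.

Lemma viscosity_integrand_ge0 (R : realType) (z x : R) : 0 <= x ->
  0 <= viscosity_integrand z x.
Proof.
move=> x0; rewrite !mulr_ge0 ?expR_ge0 ?powR_ge0//.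
by rewrite !addr_ge0 ?mulr_ge0 ?invr_ge0 ?exprn_ge0.
Qed.

(** A probability density has total mass 1. With r = 1/2 it serves as the dominating function. *)
Lemma integrable_exponential_pdf (R : realType) (r : R) : 0 < r ->
  (@lebesgue_measure R).-integrable setT (EFin \o exponential_pdf r).
Proof.
move=> r0; apply/integrableP; split.
  by apply/measurable_EFinP; apply: measurable_exponential_pdf; exact: ltW.
under eq_integral do rewrite /= ger0_norm ?exponential_pdf_ge0 ?ltW//.
by rewrite integral_exponential_pdf// ltry.
Qed.

(** A single term of the exponential series at x / 2 is at most its sum. *)
Lemma exprn_le_expR_half (R : realType) (n : nat) :
  exists2 k : R, 0 <= k & forall x, 0 <= x -> x ^+ n.+1 <= k * expR (x / 2).
Proof.
exists (2 ^+ n.+1 * n.+1`!%:R) => [|x x0]; first by rewrite mulr_ge0.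
have f0 : 0 < n.+1`!%:R :> R by rewrite ltr0n fact_gt0.
have x20 : 0 <= x / 2 by rewrite divr_ge0.
have e := expR_ge1Dxn n x20.
have : (x / 2) ^+ n.+1 / n.+1`!%:R <= expR (x / 2).
  by apply: le_trans e; rewrite lerDr.
by rewrite ler_pdivrMr// expr_div_n ler_pdivrMr// mulrC [expR _ * _]mulrC mulrA.
Qed.

(** Split e^{-x} into two factors e^{-x/2}: one absorbs the growth x^5 of the power, the other is
    the density up to a constant. *)
Lemma viscosity_integrand_le (R : realType) (z : R) : 0 < z ->
  exists C : R, 0 <= C /\ forall x, 2 / z <= x ->
    viscosity_integrand z x <= C * exponential_pdf (2^-1) x.
Proof.
move=> z0; have [k k0 kP] := @exprn_le_expR_half R 4.
(* The bracket of inverse powers decreases in x; this is its value at the endpoint x = 2 / z. *)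
pose K := z / 2 + 3 * (z / 2) ^+ 2 + 3 * (z / 2) ^+ 3.
have z20 : 0 <= z / 2 by rewrite divr_ge0 ?ltW.
have K0 : 0 <= K.
  by rewrite /K addr_ge0// ?addr_ge0// mulr_ge0// exprn_ge0.
(* [expR (2 / z)] comes from the shift in the exponential; the final 2 cancels the normalisation 1/2
   of the density. *)
exists (expR (2 / z) * K * z ^+ 5 * k * 2).
split; first by rewrite !mulr_ge0// ltW.
move=> x zx.
have x0 : 0 < x by apply: lt_le_trans zx; rewrite divr_gt0.
have Vx : x^-1 <= z / 2.
  by rewrite -(invf_div 2 z) lef_pV2 ?posrE ?divr_gt0.
have Vx0 : 0 <= x^-1 by rewrite invr_ge0 ltW.
have leK : x^-1 + 3 / x ^+ 2 + 3 / x ^+ 3 <= K.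
  rewrite -!exprVn /K !lerD// ler_pM2l//; apply: lerXn2r => //;
    by rewrite nnegrE ?(le_trans Vx0).
have leP : (z ^+ 2 * x ^+ 2 - 4) `^ (5 / 2) <= z ^+ 5 * x ^+ 5.
  rewrite -!exprMn -powR_sqr_half5; last by rewrite mulr_ge0 ?ltW.
  (* Makes the base z^2 x^2 - 4 nonnegative, as monotonicity of the real power requires. *)
  have h : 2 <= z * x by rewrite mulrC -ler_pdivrMr.
  apply: ge0_ler_powR; rewrite ?nnegrE ?sqr_ge0 ?divr_ge0//; first by nra.
  by rewrite lerBlDr lerDl.
have leE := kP x (ltW x0).
rewrite exponential_pdfE ?(ltW x0)//.
have -> : expR (2 / z) * K * z ^+ 5 * k * 2 * (2^-1 * expR (- 2^-1 * x))
  = expR (- (x - 2 / z)) * K * (z ^+ 5 * (k * expR (x / 2))).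
  have -> : - (x - 2 / z) = 2 / z + (- x) by ring.
  have -> : - 2^-1 * x = - x + x / 2 by field.
  by rewrite !expRD; field.
rewrite /viscosity_integrand.
apply: ler_pM; rewrite ?powR_ge0//.
- rewrite mulr_ge0 ?expR_ge0// -!exprVn.
  by rewrite !addr_ge0 ?mulr_ge0 ?exprn_ge0.
- by rewrite ler_pM2l ?expR_gt0.
- by apply: (le_trans leP); rewrite ler_pM2l// exprn_gt0.
Qed.

Lemma integrable_viscosity_integrand (R : realType) (z : R) : 0 < z ->
  (@lebesgue_measure R).-integrable `[2 / z, +oo[
    (EFin \o viscosity_integrand z).
Proof.
move=> z0; have [C [C0 fC]] := viscosity_integrand_le z0.
have sub : `[2 / z, +oo[ `<=` (`]0, +oo[ : set R).
  by apply: subset_itvr; rewrite bnd_simp divr_gt0.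
pose g x := (C%:E * (exponential_pdf 2^-1 x)%:E)%E.
have mD : measurable (`[2 / z, +oo[ : set R) by exact: measurable_itv.
apply: (@le_integrable _ _ R (@lebesgue_measure R) _ mD
  (EFin \o viscosity_integrand z) g).
- apply/measurable_EFinP; apply: measurable_funS sub _ => //.
  exact: measurable_viscosity_integrand.
- move=> x /= Dx; rewrite lee_fin.
  have x0 : 0 < x by have := sub _ Dx; rewrite /= in_itv/= andbT.
  rewrite ger0_norm; last by rewrite viscosity_integrand_ge0 ?(ltW x0).
  apply: le_trans (ler_norm _).
  by apply: fC; move: Dx; rewrite in_itv/= andbT.
- apply: integrableZl => //.
  apply: (integrableS measurableT) => //.
  by apply: integrable_exponential_pdf; rewrite invr_gt0.
Qed.

Lemma viscosity_integrand_ge (R : realType) (z x : R) : 0 < z -> z <= 1 / 4 ->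
  2 / z + 1 <= x <= 2 / z + 2 ->
  16 * expR (- 2) * z ^+ 4 <= viscosity_integrand z x.
Proof.
move=> z0 z4 /andP[x1 x2].
have z20 : 0 < 2 / z by rewrite divr_gt0.
have x0 : 0 < x by lra.
have zz : z * (2 / z) = 2 by field; rewrite gt_eqF.
(* Here z x <= 2 + 2 z <= 4. *)
have Vx : z / 4 <= x^-1.
  by rewrite -(invf_div 4 z) lef_pV2 ?posrE ?divr_gt0// ler_pdivlMr//; nra.
have Vx0 : 0 <= x^-1 by rewrite invr_ge0 ltW.
have leV : z / 4 <= x^-1 + 3 / x ^+ 2 + 3 / x ^+ 3.
  rewrite -!exprVn -addrA; apply: (le_trans Vx); rewrite lerDl.
  by rewrite addr_ge0 ?mulr_ge0 ?exprn_ge0.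
have leP : 64 * z ^+ 3 <= (z ^+ 2 * x ^+ 2 - 4) `^ (5 / 2).
  have z41 : 0 < 4 * z <= 1 by lra.
  have -> : 64 * z ^+ 3 = (4 * z) ^+ 3 by rewrite exprMn; congr (_ * _); ring.
  (* From z x >= 2 + z one gets (z x)^2 - 4 >= 4 z + z^2. *)
  have h : 4 * z <= z ^+ 2 * x ^+ 2 - 4.
    have : 2 + z <= z * x by nra.
    by rewrite -exprMn; nra.
  (* As 0 < 4 z <= 1, raising the exponent from 5/2 to 3 lowers the power; this leaves an integer
     exponent. *)
  apply: (@le_trans _ _ ((4 * z) `^ (5 / 2))).
    rewrite -powR_mulrn; last lra.
    by apply: ger_powR => //; lra.
  by apply: ge0_ler_powR => //; rewrite ?nnegrE; lra.
have leE : expR (- 2) <= expR (- (x - 2 / z)) by rewrite ler_expR; lra.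
have -> : 16 * expR (- 2) * z ^+ 4 = expR (- 2) * (z / 4) * (64 * z ^+ 3).
  by field.
rewrite /viscosity_integrand.
have zge0 := ltW z0.
apply: ler_pM => //; first by rewrite !mulr_ge0 ?expR_ge0.
  by rewrite mulr_ge0 ?exprn_ge0.
by apply: ler_pM => //; rewrite ?expR_ge0 ?mulr_ge0.
Qed.

(** The interval [A] has length 1, so the pointwise bound on it is already a bound for the integral
    over [A]. *)
Lemma viscosity_integral_ge (R : realType) (z : R) : 0 < z -> z <= 1 / 4 ->
  16 * expR (- 2) * z ^+ 4 <= viscosity_integral z.
Proof.
move=> z0 z4; set a := 16 * _ * _.
pose A : set R := `[2 / z + 1, 2 / z + 2]%classic.
have AD : A `<=` `[2 / z, +oo[ by apply: subset_itv; rewrite bnd_simp; lra.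
have fD := integrable_viscosity_integrand z0.
have f0 x : `[2 / z, +oo[%classic x -> 0 <= viscosity_integrand z x.
  rewrite /= in_itv/= andbT => zx; apply: viscosity_integrand_ge0.
  by apply: le_trans zx; rewrite divr_ge0 ?ltW.
have mA : measurable A by exact: measurable_itv.
have muA : lebesgue_measure A = 1%E.
  rewrite lebesgue_measure_itv/= lte_fin.
  rewrite ifT; last lra.
  by rewrite -EFinD; congr EFin; ring.
(* Integrability makes the extended integral finite, so [fine] loses nothing and the comparison can
   be made in the extended reals. *)
rewrite -lee_fin /viscosity_integral /Rintegral fineK; last first.
  exact: (integrable_fin_num _ fD).
have -> : a%:E = (\int[lebesgue_measure]_(x in A) cst a%:E x)%E.
  by rewrite integral_cst// [X in (_ * X)%E]muA mule1.
apply: (@le_trans _ _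
  (\int[lebesgue_measure]_(x in A) (viscosity_integrand z x)%:E)%E).
  apply: ge0_le_integral => //.
  - by move=> x _; rewrite lee_fin !mulr_ge0 ?expR_ge0 ?exprn_ge0 ?ltW.
  - have /integrableP[mf _] := fD.
    exact: measurable_funS AD mf.
  - move=> x; rewrite /A/= in_itv/= => Ax.
    by rewrite lee_fin viscosity_integrand_ge.
apply: ge0_subset_integral => //.
by have /integrableP[] := fD.
Qed.

Lemma bulk_viscosity_bounds (R : realType) (m c d z : R) :
  0 < m -> 0 < c -> 0 < d -> 0 < z -> z <= 1 / 4 ->
  0 < bulk_viscosity m c d z <=
    30 * m * c / d * (16 * expR (- 2))^-1 * z ^+ 2.
Proof.
move=> m0 c0 d0 z0 z4.
have ge := viscosity_integral_ge z0 z4.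
have e0 : 0 < 16 * expR (- 2 : R) by rewrite mulr_gt0 ?expR_gt0.
have a0 : 0 < 16 * expR (- 2) * z ^+ 4 by rewrite mulr_gt0 ?exprn_gt0.
have I0 := lt_le_trans a0 ge.
have C0 : 0 < 30 * m * c / d by rewrite !mulr_gt0 ?invr_gt0.
(* Lets the denominator be dropped from the upper bound, leaving z^6 / z^4. *)
have q1 : 1 <= (2 * z ^+ 2 + 4 * z + 1) ^+ 2.
  by rewrite exprn_ege1// lerDr addr_ge0 ?mulr_ge0 ?exprn_ge0 ?ltW.
have q0 := lt_le_trans ltr01 q1.
rewrite /bulk_viscosity; apply/andP; split.
  by rewrite !mulr_gt0 ?invr_gt0// exprn_gt0.
have -> : 30 * m * c / d * (16 * expR (- 2))^-1 * z ^+ 2 =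
    30 * m * c / d * z ^+ 6 * (16 * expR (- 2) * z ^+ 4)^-1.
  by field; rewrite !gt_eqF ?expR_gt0.
apply: ler_pM.
- by rewrite ltW// mulr_gt0// divr_gt0// exprn_gt0.
- by rewrite invr_ge0 ltW.
- by rewrite ler_pM2l// ler_pdivrMr// ler_peMr// exprn_ge0 ?ltW.
- by rewrite lef_pV2.
Qed.

Theorem theorem1 (R : realType) (m c d : R)
    (m_gt0 : 0 < m) (c_gt0 : 0 < c) (d_gt0 : 0 < d) :
  (bulk_viscosity m c d z @[z --> 0^'+] --> (0 : R))
  /\ (\forall z \near 0^'+, 0 < bulk_viscosity m c d z).
Proof.
pose C : R := 30 * m * c / d * (16 * expR (- 2))^-1.
(* One eventual two-sided bound yields both the positivity and the squeeze. *)
have H : \forall z \near (0:R)^'+,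
    0 < bulk_viscosity m c d z <= C * z ^+ 2.
  near=> z; apply: bulk_viscosity_bounds => //.
  by near: z; apply: nbhs_right_le; lra.
split; last by apply: filterS H => z /andP[].
apply: (@squeeze_cvgr _ _ _ _ (cst 0) (fun z => C * z ^+ 2)).
- by apply: filterS H => z /andP[/ltW -> ->].
- exact: cvg_cst.
(* The majorant is continuous at 0, so its right limit is its value there. *)
- apply: cvg_at_right_filter.
  rewrite -[X in _ --> X](_ : C * 0 ^+ 2 = 0); last by rewrite expr0n mulr0.
  by apply: cvgM; [exact: cvg_cst|exact: exprn_continuous].
Unshelve. all: by end_near. Qed.
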